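(* Let $R$ be a Dedekind domain with $\operatorname{char}(R)\neq3$ and fraction field $K$, let $\mathfrak a$ be a fractional ideal of $R$, and let $S$ be a nondegenerate quadratic $R$-algebra with $\operatorname{St}(S)=[\mathfrak a]$, equipped with an $\mathfrak a$-orientation. Consider the set of $\approx$-classes of $\mathfrak a$-balanced quadruples $(S,I,\delta,s)$ with first entry $S$ and $I$ an invertible fractional ideal of $S$. The map $(S,I,\delta,s)\mapsto[I]$ is a surjective homomorphism from this set onto $\operatorname{Cl}(S/R)[3]$, and its kernel is isomorphic to $S^\times_{N=1}/S^{\times3}_{N=1}$, where $S^\times_{N=1}$ is the group of units of $S$ of norm $1$ and $S^{\times3}_{N=1}=\{x^3: x\in S^\times_{N=1}\}$.
   Context: $L=S\otimes_RK$, $N=N_{L/K}$. Module index $[M:N]_R$ for rank-$n$ lattices in an $n$-dimensional $K$-space: the fractional ideal of $R$ whose localization at each prime $\mathfrak p$ is $\det(\phi)R_{(\mathfrak p)}$ for any $K$-linear $\phi$ with $\phi(M_{(\mathfrak p)})=N_{(\mathfrak p)}$. $\operatorname{Cl}(S)$ = invertible fractional ideals mod principal ones; $\operatorname{Cl}(S/R)$ = kernel of the norm $\operatorname{Cl}(S)\to\operatorname{Cl}(R)$, $I\mapsto[S:I]_R$. An $\mathfrak a$-orientation is an isomorphism $\bigwedge^2S\to\mathfrak a$. An $\mathfrak a$-balanced quadruple $(S,I,\delta,s)$: $S$ a nondegenerate $\mathfrak a$-oriented quadratic $R$-algebra, $I$ a fractional ideal of $S$, $\delta\in(S\otimes_RK)^\times$,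 $s\in K^\times$, with $I^3\subset\delta S$, $[S:I]_R=sR$, $s^3=N(\delta)$. $(S,I,\delta,s)\approx(S',I',\delta',s')$ if there is a ring isomorphism $\phi:S\to S'$ (not necessarily preserving orientation) and $\kappa\in S'\otimes_RK$ with $I'=\kappa\phi(I)$, $\delta'=\kappa^3\phi(\delta)$, $s'=N(\kappa)s$. Quadruples with fixed $S$ are multiplied componentwise.
   Formalization: The equivalence ≈ on quadruples with first entry S is taken with φ = identity (only scaling by κ ∈ L^×); allowing φ = conjugation would identify I with its conjugate, whose class is [I]^{-1}, so the map to [I] would not be well defined. *)

(* Defs.v *)
From HB Require Import structures.
From mathcomp Require Import all_boot all_order all_algebra all_field.
Set Implicit Arguments. Unset Strict Implicit. Unset Printing Implicit Defensive.
Import Order.TTheory GRing.Theory.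
Local Open Scope ring_scope.

(* Conventions.  K is a field (the fraction field of R), R is given as a
   subring of K (a predicate K -> Prop).  L = S (x)_R K is a commutative
   2-dimensional K-algebra (an falgType over K), and S, fractional ideals
   of S, etc. are predicates L -> Prop.                                  *)

Section Defs.
Variables (K : fieldType) (L : falgType K).

Definition set_eq (T : Type) (A B : T -> Prop) := forall x, A x <-> B x.

Definition subringK (R : K -> Prop) :=
  [/\ R 0, R 1, (forall x y, R x -> R y -> R (x - y))
    & (forall x y, R x -> R y -> R (x * y))].

Definition is_frac_field (R : K -> Prop) :=
  forall x : K, exists a b, [/\ R a, R b, b != 0 & x = a / b].

Definition RspanK (R : K -> Prop) (s : seq K) (x : K) :=
  exists c : seq K, [/\ size c = size s, (forall i, R c`_i)
                      & x = \sum_(i < size s) c`_i * s`_i].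

Definition RspanL (R : K -> Prop) (s : seq L) (v : L) :=
  exists c : seq K, [/\ size c = size s, (forall i, R c`_i)
                      & v = \sum_(i < size s) c`_i *: s`_i].

Definition idealR (R : K -> Prop) (I : K -> Prop) :=
  [/\ (forall x, I x -> R x), I 0,
      (forall x y, I x -> I y -> I (x + y))
    & (forall r x, R r -> I x -> I (r * x))].

Definition prime_idealR (R : K -> Prop) (P : K -> Prop) :=
  [/\ idealR R P, ~ P 1
    & (forall a b, R a -> R b -> P (a * b) -> P a \/ P b)].

Definition maximal_idealR (R : K -> Prop) (P : K -> Prop) :=
  [/\ idealR R P, ~ P 1
    & (forall J, idealR R J -> (forall x, P x -> J x) ->
         set_eq J P \/ J 1)].

Definition noetherianR (R : K -> Prop) :=
  forall I, idealR R I -> exists s : seq K, (forall i, R s`_i) /\ set_eq I (RspanK R s).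

Definition integrally_closedR (R : K -> Prop) :=
  forall x : K, (exists p : {poly K},
     [/\ p \is monic, (forall i, R p`_i) & root p x]) -> R x.

Definition dim_le1R (R : K -> Prop) :=
  forall P, prime_idealR R P -> (exists x, P x /\ x != 0) -> maximal_idealR R P.

Definition dedekind_with_frac_field (R : K -> Prop) :=
  [/\ subringK R, is_frac_field R, noetherianR R, integrally_closedR R
    & dim_le1R R].

Definition frac_idealR (R : K -> Prop) (a : K -> Prop) :=
  exists s : seq K, set_eq a (RspanK R s) /\ exists x, a x /\ x != 0.

Definition locK (R P : K -> Prop) (J : K -> Prop) (x : K) :=
  exists a b, [/\ J a, R b, ~ P b & x = a / b].

Definition locL (R P : K -> Prop) (M : L -> Prop) (v : L) :=
  exists m b, [/\ M m, R b, ~ P b & v = b^-1 *: m].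

Definition ldet (f : 'End(L)) : K := \det (passmx.mxof (vbasis fullv) (vbasis fullv) f).
Definition ltrace (f : 'End(L)) : K := \tr (passmx.mxof (vbasis fullv) (vbasis fullv) f).

Definition normLK (x : L) : K := ldet (amull x).
Definition traceLK (x : L) : K := ltrace (amull x).

Definition discLK : K :=
  \det (\matrix_(i < \dim {:L}, j < \dim {:L}) traceLK ((vbasis (fullv : {vspace L}))`_i
                                 * (vbasis (fullv : {vspace L}))`_j)).

Definition latticeL (R : K -> Prop) (M : L -> Prop) :=
  exists s : seq L, set_eq M (RspanL R s) /\ <<s>>%VS = fullv.

(* module index: [M : N]_R = J, i.e. for every prime p, J_(p) = det(phi) R_(p)
   for every K-linear phi with phi(M_(p)) = N_(p) *)
Definition index_is (R : K -> Prop) (M N : L -> Prop) (J : K -> Prop) :=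
  forall P, prime_idealR R P -> forall phi : 'End(L),
    set_eq (locL R P N) (fun v => exists w, locL R P M w /\ phi w = v) ->
    set_eq (locK R P J) (fun x => exists r, locK R P R r /\ x = ldet phi * r).

Definition principalR (R : K -> Prop) (c : K) (x : K) := exists r, R r /\ x = c * r.

Definition L_commutative := forall x y : L, x * y = y * x.

Definition quadratic_alg (R : K -> Prop) (S : L -> Prop) :=
  [/\ S 1, (forall x y, S x -> S y -> S (x - y)),
      (forall x y, S x -> S y -> S (x * y)),
      (forall r x, R r -> S x -> S (r *: x)) & latticeL R S].

Definition nondegenerateLK := discLK != 0.

(* an a-orientation: an isomorphism wedge^2 S -> a, encoded by its
   K-linear extension wedge^2_K L -> K, i.e. an alternating K-bilinear form
   omega on L whose values on S x S span exactly a over R *)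
Definition orientation (R : K -> Prop) (S : L -> Prop) (a : K -> Prop)
    (omega : L -> L -> K) :=
  [/\ (forall c x y z, omega (c *: x + y) z = c * omega x z + omega y z),
      (forall c x y z, omega z (c *: x + y) = c * omega z x + omega z y),
      (forall x, omega x x = 0)
    & set_eq a (fun t => exists s : seq (L * L),
          (forall i, S (s`_i).1 /\ S (s`_i).2) /\
          exists c : seq K, [/\ size c = size s, (forall i, R c`_i) &
              t = \sum_(i < size s) c`_i * omega (s`_i).1 (s`_i).2])].

Definition prodL (I J : L -> Prop) (v : L) :=
  exists s : seq (L * L), (forall i, I (s`_i).1 /\ J (s`_i).2) /\
                          v = \sum_(i < size s) (s`_i).1 * (s`_i).2.

Definition scaleL (k : L) (I : L -> Prop) (v : L) := exists w, I w /\ v = k * w.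

Definition frac_idealS (R : K -> Prop) (S I : L -> Prop) :=
  latticeL R I /\ (forall x y, S x -> I y -> I (x * y)).

Definition invertibleS (R : K -> Prop) (S I : L -> Prop) :=
  frac_idealS R S I /\ exists J, frac_idealS R S J /\ set_eq (prodL I J) S.

Definition cubeL (I : L -> Prop) := prodL (prodL I I) I.

Definition cl_equiv (I J : L -> Prop) :=
  exists k : L, k \is a GRing.unit /\ set_eq J (scaleL k I).

Definition in_ClSR3 (R : K -> Prop) (S I : L -> Prop) :=
  [/\ invertibleS R S I,
      (exists c : K, c != 0 /\ index_is R S I (principalR R c))
    & cl_equiv S (cubeL I)].

(* a quadruple (S, I, delta, s) with fixed S is stored as the triple (I, delta, s) *)
Definition quad := ((L -> Prop) * L * K)%type.

Definition balanced (R : K -> Prop) (S : L -> Prop) (q : quad) :=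
  let I := q.1.1 in let delta := q.1.2 in let s := q.2 in
  [/\ frac_idealS R S I, delta \is a GRing.unit, s != 0,
      (forall v, cubeL I v -> scaleL delta S v)
    & index_is R S I (principalR R s) /\ s ^+ 3 = normLK delta].

Definition inQ (R : K -> Prop) (S : L -> Prop) (q : quad) :=
  balanced R S q /\ invertibleS R S q.1.1.

Definition qmul (q q' : quad) : quad :=
  (prodL q.1.1 q'.1.1, q.1.2 * q'.1.2, q.2 * q'.2).

(* the equivalence ~ on quadruples with first entry S (phi = id) *)
Definition qequiv (q q' : quad) :=
  exists k : L, [/\ k \is a GRing.unit, set_eq q'.1.1 (scaleL k q.1.1),
                   q'.1.2 = k ^+ 3 * q.1.2 & q'.2 = normLK k * q.2].

Definition unitN1 (S : L -> Prop) (u : L) :=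
  [/\ S u, (exists v, S v /\ u * v = 1) & normLK u = 1].

Definition cubeN1 (S : L -> Prop) (u : L) := exists x, unitN1 S x /\ u = x ^+ 3.

End Defs.

(* Main.v *)
Require Import Defs.
From HB Require Import structures.
From mathcomp Require Import all_boot all_order all_algebra all_field ring.
From mathcomp Require boolp classical_sets.
Import GRing.Theory.
Local Open Scope ring_scope.

(** The orientation [omega] gives a uniform handle on norms:
    [omega (f x) (f y) = det f * omega x y], so the determinant of a map
    preserving [S] multiplies the finitely generated module [a] into itself and
    lies in the integrally closed ring [R].

    An invertible ideal [I], with inverse [J], is locally principal at every prime
    [P] of [R]. Indeed, if [N (x y)] were in [P] for all [x] in [I] and [y] in [J],
    polarizing twice would show that the polar form [B] of [N] satisfies
    [B (x1 y1) (x2 y2) + B (x1 y2) (x2 y1) = B x1 x2 * B y1 y2] in [P], and the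
    product of these two terms would be in [P] as well; so both terms would be
    in [P], and expanding [1 = sum x_i y_i] would give [N 1] in [P]. When [N (x y)]
    is not in [P], [x] generates [I] at [P], and the index of [I] at [P] is [N x].

    Comparing indices prime by prime then shows that [I^3 = delta S] for every
    balanced quadruple, that indices are multiplicative, and that an ideal of
    [Cl(S/R)[3]] can be completed to a balanced quadruple. In the kernel [I = k S]
    with [N k = s] for some [k], unique up to units of norm 1, and the quadruple
    is sent to [delta / k^3]. *)

(** * Prime ideals of a subring of a field *)

Section SubringOfField.
Variables (K : fieldType) (R : K -> Prop).
Hypothesis subR : subringK R.

Lemma subringK0 : R 0. Proof. by case: subR. Qed.
Lemma subringK1 : R 1. Proof. by case: subR. Qed.
Lemma subringKB x y : R x -> R y -> R (x - y).
Proof. by case: subR => _ _ + _; apply. Qed.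
Lemma subringKM x y : R x -> R y -> R (x * y).
Proof. by case: subR => _ _ _; apply. Qed.
Lemma subringKN x : R x -> R (- x).
Proof. by rewrite -sub0r => Rx; apply: subringKB => //; apply: subringK0. Qed.
Lemma subringKD x y : R x -> R y -> R (x + y).
Proof. by move=> Rx Ry; rewrite -[y]opprK; apply: subringKB => //; apply: subringKN. Qed.
Lemma subringKX x n : R x -> R (x ^+ n).
Proof.
by move=> Rx; elim: n => [|n IH]; [apply: subringK1 | rewrite exprS; apply: subringKM].
Qed.

(** Applied to a characteristic matrix, this puts the characteristic polynomial of a matrix over [R]
    in [R[X]]. *)
Lemma subringK_coef_det n (A : 'M[{poly K}]_n) :
  (forall i j k, R (A i j)`_k) -> forall k, R (\det A)`_k.
Proof.
move=> RA; rewrite /determinant.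
have RM (p q : {poly K}) : (forall k, R p`_k) -> (forall k, R q`_k) ->
    forall k, R (p * q)`_k.
  move=> Rp Rq k; rewrite coefM; apply: (big_ind R).
  - exact: subringK0.
  - exact: subringKD.
  - by move=> i _; apply: subringKM.
have R1 k : R (1 : {poly K})`_k.
  by rewrite coef1; case: (k == _); [apply: subringK1 | apply: subringK0].
apply: (big_ind (fun p : {poly K} => forall k, R p`_k)).
- by move=> k; rewrite coef0; apply: subringK0.
- by move=> p q Rp Rq k; rewrite coefD; apply: subringKD.
move=> s _; apply: (RM).
  case: (perm.odd_perm s) => //= k.
  by rewrite expr1 coefN; apply: subringKN.
apply: (big_ind (fun p : {poly K} => forall k, R p`_k)) => //.
Qed.

(* The determinant trick: [c] is an eigenvalue of a matrix over [R] expressing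
   multiplication by [c] on generators of [a]. *)
Lemma multiplier_in_integrally_closed (a : K -> Prop) (c : K) :
  integrally_closedR R -> frac_idealR R a ->
  (forall x, a x -> a (c * x)) -> R c.
Proof.
move=> icR [s [as_ [x [ax xN0]]]] ca.
have as_i (i : 'I_(size s)) : a s`_i.
  apply/as_; exists (mkseq (fun j => (j == i)%:R) (size s)).
  rewrite size_mkseq; split=> //.
    move=> j; case: (ltnP j (size s)) => ljs.
      by rewrite nth_mkseq //; case: (j == i); [apply: subringK1 | apply: subringK0].
    by rewrite nth_default ?size_mkseq //; apply: subringK0.
  rewrite (bigD1 i) //= nth_mkseq // eqxx mul1r big1 ?addr0 // => j jNi.
  by rewrite nth_mkseq // (negbTE (jNi : (j : nat) != i)) mul0r.
have /fin_all_exists[C CE] (i : 'I_(size s)) : exists u : seq K,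
    [/\ size u = size s, (forall k, R u`_k)
      & c * s`_i = \sum_(j < size s) u`_j * s`_j].
  by apply/as_/ca/as_i.
(* This index order makes the row of generators a left eigenvector of [A], as [eigenvalueP]
   requires. *)
pose A := \matrix_(j < size s, i < size s) (C i)`_j.
apply: icR; exists (char_poly A); split; first exact: char_poly_monic.
  apply: subringK_coef_det => i j k; rewrite !mxE coefB coefC.
  apply: subringKB.
    rewrite coefMn coefX; case: (k == 1)%N; case: (i == j);
      rewrite ?mulr0n ?mulr1n; by [apply: subringK1 | apply: subringK0].
  by case: (k == 0)%N; [case: (CE j) | apply: subringK0].
rewrite -eigenvalue_root_char; apply/eigenvalueP.
exists (\row_(i < size s) s`_i).
  apply/rowP => i; rewrite !mxE; have [_ _ ->] := CE i.
  by apply: eq_bigr => j _; rewrite !mxE mulrC.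
(* The eigenvector is nonzero: otherwise every element of [a], in particular [x], would vanish. *)
apply/eqP => /rowP s0; move: xN0; case/as_: ax => d [_ _ ->].
by rewrite big1 ?eqxx // => i _; move: (s0 i); rewrite !mxE => ->; rewrite mulr0.
Qed.

Lemma prime_idealB P x y : prime_idealR R P -> P x -> P y -> P (x - y).
Proof.
move=> [[_ _ PD PM] _ _] Px Py; apply: PD => //; rewrite -mulN1r; apply: PM => //.
by apply: subringKN; apply: subringK1.
Qed.

Lemma prime_ideal0 : prime_idealR R (fun x => x = 0).
Proof.
split; first split => //.
- by move=> x ->; apply: subringK0.
- by move=> x y -> ->; rewrite addr0.
- by move=> r x _ ->; rewrite mulr0.
- by move/eqP; rewrite oner_eq0.
by move=> x y _ _ /eqP; rewrite mulf_eq0 => /orP[] /eqP; [left | right].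
Qed.

Lemma prime_mulN P b c : prime_idealR R P -> R b -> ~ P b -> R c -> ~ P c -> ~ P (b * c).
Proof. by move=> [_ _ Pp] Rb Pb Rc Pc /Pp[]. Qed.

Lemma prime_notin_neq0 P b : prime_idealR R P -> ~ P b -> b != 0.
Proof. by move=> [[_ P0 _ _] _ _]; apply: contra_notN => /eqP->. Qed.

(** * Existence of primes and the local-global principle *)

Lemma maximal_ideal_prime (P : K -> Prop) :
  idealR R P -> ~ P 1 ->
  (forall J, idealR R J -> (forall x, P x -> J x) -> ~ J 1 ->
     forall x, J x -> P x) ->
  prime_idealR R P.
Proof.
move=> idP PN1 maxP; split=> // x y Rx Ry Pxy.
have [PR P0 PD PM] := idP.
case: (boolp.EM (P x)) => [|PNx]; first by left.
right.
pose J z := exists p r, [/\ P p, R r & z = p + r * x].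
have idJ : idealR R J.
  split.
  - by move=> _ [p [r [Pp Rr ->]]]; apply: subringKD; [apply: PR | apply: subringKM].
  - exists 0, 0; split=> //; [exact: subringK0 | by rewrite mul0r addr0].
  - move=> _ _ [p [r [Pp Rr ->]]] [p' [r' [Pp' Rr' ->]]].
    exists (p + p'), (r + r'); split; [exact: PD | exact: subringKD | ring].
  - move=> t _ Rt [p [r [Pp Rr ->]]].
    exists (t * p), (t * r); split; [exact: PM | exact: subringKM | ring].
have PJ z : P z -> J z.
  by move=> Pz; exists z, 0; split=> //; [exact: subringK0 | rewrite mul0r addr0].
case: (boolp.EM (J 1)) => [[p [r [Pp Rr E]]]|JN1].
  have -> : y = y * p + r * (x * y) by rewrite -[LHS]mulr1 E; ring.
  by apply: PD; apply: PM.
case: PNx; apply: (maxP _ idJ PJ JN1).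
by exists 0, 1; split=> //; [exact: subringK1 | rewrite mul1r add0r].
Qed.

Lemma exists_prime_above (I : K -> Prop) :
  idealR R I -> ~ I 1 -> exists P, prime_idealR R P /\ forall x, I x -> P x.
Proof.
move=> idI IN1.
pose good (X : K -> Prop) := [/\ idealR R X, ~ X 1 & forall x, I x -> X x].
(* The empty set is admitted because Zorn's lemma is also applied to the empty chain. *)
pose P X := good X \/ forall x, ~ X x.
have [|M [PM maxM]] := @classical_sets.Zorn_bigcup K P.
  move=> F FP Ftot.
  case: (boolp.EM (exists X, F X /\ good X)) => [[X0 [FX0 gX0]]|noX]; last first.
    right=> x [X FX Xx]; case: (FP _ FX) => [gX|X0]; last exact: X0 Xx.
    by apply: noX; exists X.
  left.
  have Fg X x : F X -> X x -> good X.
    by move=> FX Xx; case: (FP _ FX) => // X_0; case: (X_0 _ Xx).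
  split.
  - split.
    + by move=> x [X FX Xx]; case: (Fg _ _ FX Xx) => [[+ _ _ _] _ _]; apply.
    + by exists X0 => //; case: gX0 => [[]].
    + move=> x y [X FX Xx] [Y FY Yy].
      have [[_ _ XD _] _ _] := Fg _ _ FX Xx.
      have [[_ _ YD _] _ _] := Fg _ _ FY Yy.
      case: (Ftot _ _ FX FY) => sub.
        by exists Y => //; apply: YD => //; apply: sub.
      by exists X => //; apply: XD => //; apply: sub.
    + move=> r x Rr [X FX Xx]; exists X => //.
      by case: (Fg _ _ FX Xx) => [[_ _ _ +] _ _]; apply.
  - by move=> [X FX X1]; case: (Fg _ _ FX X1).
  - by move=> x Ix; exists X0 => //; case: gX0 => _ _; apply.
have proper_sub (X Y : K -> Prop) z : (forall x, X x -> Y x) -> Y z -> ~ X z ->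
    classical_sets.proper X Y by move=> XY Yz nXz; split=> // /(_ _ Yz).
have goodI : good I by split.
have I0 : I 0 by case: idI.
case: PM => [gM|M0]; last first.
  case: (maxM I) => //; last by left.
  by apply: (proper_sub _ _ 0) => // x /M0.
have [idM MN1 IM] := gM.
exists M; split=> //; apply: maximal_ideal_prime => // J idJ MJ JN1 x Jx.
apply: boolp.contrapT => nMx; apply: (maxM J); first exact: (proper_sub _ _ x).
by left; split=> // z /IM/MJ.
Qed.

Lemma ideal_not_in_primes (I : K -> Prop) :
  idealR R I -> (forall P, prime_idealR R P -> exists x, I x /\ ~ P x) -> I 1.
Proof.
move=> idI noP; apply: boolp.contrapT => IN1.
have [P [prP IP]] := exists_prime_above _ idI IN1.
by have [x [/IP]] := noP _ prP.
Qed.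

(** The denominators [b] with [b * x] in [R] form an ideal contained in no prime, so [1] is one of
    them. *)
Lemma mem_of_local x :
  (forall P, prime_idealR R P -> exists b, [/\ R b, ~ P b & R (b * x)]) -> R x.
Proof.
move=> loc; suff : (fun b => R b /\ R (b * x)) 1 by rewrite mul1r => -[].
apply: (ideal_not_in_primes (fun b => R b /\ R (b * x))); last by move=> P /loc[b []]; exists b.
split=> [b []//||b c [Rb Rbx] [Rc Rcx]|r b Rr [Rb Rbx]].
- by rewrite mul0r; split; apply: subringK0.
- by rewrite mulrDl; split; apply: subringKD.
- by rewrite -mulrA; split; apply: subringKM.
Qed.

End SubringOfField.
(** * The norm form of a quadratic algebra *)

(* A copy of [L] that is canonically commutative, on which [ring] applies. *)
Definition comL (K : fieldType) (L : falgType K) of L_commutative L : Type := L.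
HB.instance Definition _ (K : fieldType) (L : falgType K) (mulLC : L_commutative L) :=
  GRing.NzRing.on (comL K L mulLC).
HB.instance Definition _ (K : fieldType) (L : falgType K) (mulLC : L_commutative L) :=
  GRing.PzRing_hasCommutativeMul.Build (comL K L mulLC) mulLC.

Section QuadraticAlgebra.
Variables (K : fieldType) (L : falgType K).
Variables (R a : K -> Prop) (S : L -> Prop) (omega : L -> L -> K).
Hypothesis dedR : dedekind_with_frac_field R.
Hypothesis fracA : frac_idealR R a.
Hypothesis mulLC : L_commutative L.
Hypothesis dimL : \dim {:L} = 2%N.
Hypothesis quadS : quadratic_alg R S.
Hypothesis orS : orientation R S a omega.

Ltac ringL :=
  lazymatch goal with |- @eq _ ?x ?y => change (@eq (comL K L mulLC) x y) end; ring.

Let subR : subringK R. Proof. by case: dedR. Qed.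

Let omegaPl c x y z : omega (c *: x + y) z = c * omega x z + omega y z.
Proof. by case: orS. Qed.
Let omegaPr c x y z : omega z (c *: x + y) = c * omega z x + omega z y.
Proof. by case: orS. Qed.
Let omegaxx x : omega x x = 0. Proof. by case: orS. Qed.

Lemma omegaDl x y z : omega (x + y) z = omega x z + omega y z.
Proof. by have := omegaPl 1 x y z; rewrite scale1r mul1r. Qed.
Lemma omegaDr x y z : omega z (x + y) = omega z x + omega z y.
Proof. by have := omegaPr 1 x y z; rewrite scale1r mul1r. Qed.
Lemma omega0l z : omega 0 z = 0.
Proof. by apply: (@addrI _ (omega 0 z)); rewrite -omegaDl !addr0. Qed.
Lemma omega0r z : omega z 0 = 0.
Proof. by apply: (@addrI _ (omega z 0)); rewrite -omegaDr !addr0. Qed.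
Lemma omegaZl c x z : omega (c *: x) z = c * omega x z.
Proof. by have := omegaPl c x 0 z; rewrite omega0l !addr0. Qed.
Lemma omegaZr c x z : omega z (c *: x) = c * omega z x.
Proof. by have := omegaPr c x 0 z; rewrite omega0r !addr0. Qed.
Lemma omegaC x y : omega x y = - omega y x.
Proof.
apply/eqP; rewrite -addr_eq0; have := omegaxx (x + y).
by rewrite omegaDl !omegaDr !omegaxx add0r addr0 => ->.
Qed.

(** The size is a variable with [n = 2] because it gets instantiated with [\dim {:L}], which equals
    2 only propositionally. *)
Lemma omega_det n (A : 'M[K]_n) (e f : 'I_n -> L) (c d : 'I_n -> K) : n = 2 ->
  (forall i, f i = \sum_j A i j *: e j) ->
  omega (\sum_i c i *: f i) (\sum_i d i *: f i)
    = \det A * omega (\sum_i c i *: e i) (\sum_i d i *: e i).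
Proof.
move=> n2; subst n => fE.
have detA : \det A = A 0 0 * A 1 1 - A 0 1 * A 1 0.
  rewrite (expand_det_row _ 0) !big_ord_recl big_ord0 addr0 /cofactor !det_mx11 !mxE.
  rewrite /= expr0 expr1 mul1r mulN1r mulrN.
  by congr (_ * A _ _ - A _ _ * A _ _); apply: val_inj.
rewrite detA !big_ord_recl !big_ord0 !fE !big_ord_recl !big_ord0 !addr0.
rewrite !(lift0, omegaDl, omegaDr, omegaZl, omegaZr, omegaxx).
have -> : lift ord0 ord0 = 1 :> 'I_2 by apply: val_inj.
by rewrite -[ord0]/(0 : 'I_2) [omega (e 1) (e 0)]omegaC; ring.
Qed.

(** Coordinates in [vbasis] reduce this to the 2 by 2 case; from here on determinants are handled
    without matrices. *)
Lemma omega_lfun (f : 'End(L)) x y : omega (f x) (f y) = ldet f * omega x y.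
Proof.
pose e := vbasis (fullv : {vspace L}).
have be : basis_of fullv e := vbasisP _.
have sumE v : v = \sum_i coord e i v *: e`_i by apply: coord_vbasis; rewrite memvf.
have fsum v : f v = \sum_i coord e i v *: f e`_i.
  by rewrite {1}(sumE v) linear_sum; apply: eq_bigr => i _; rewrite linearZ.
rewrite (fsum x) (fsum y) [in RHS](sumE x) [in RHS](sumE y).
apply: omega_det => // i; rewrite {1}(sumE (f e`_i)); apply: eq_bigr => j _.
rewrite passmx.coord_rVof (passmx.rVof_app _ be) passmx.rVofE //.
by rewrite -rowE mxE.
Qed.

Lemma omega_neq0 : exists x y, omega x y != 0.
Proof.
have [s [_ [t [at_ tN0]]]] := fracA.
apply: boolp.contrapT => no; case/eqP: tN0; case: orS => _ _ _ /(_ t)[/(_ at_)].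
move=> [u [_ [c [_ _ ->]]]] _; rewrite big1 // => i _.
have [->|nz] := eqVneq (omega (u`_i).1 (u`_i).2) 0; first by rewrite mulr0.
by case: no; exists (u`_i).1, (u`_i).2.
Qed.

(** Pairing the difference [w] with the two basis vectors reads off its coordinates up to sign and
    the factor [omega e0 e1], which is nonzero since otherwise [omega] would vanish identically. *)
Lemma omega_inj u v : (forall y, omega u y = omega v y) -> u = v.
Proof.
move=> uv; apply/eqP; rewrite -subr_eq0; apply/eqP.
have {uv}: forall y, omega (u - v) y = 0.
  by move=> y; rewrite omegaDl uv -scaleN1r omegaZl mulN1r subrr.
move: (u - v) => {u v}w w0.
have [x0 [y0]] := omega_neq0.
have sumE n (e : n.-tuple L) : n = 2 ->
    (forall v, v = \sum_i coord e i v *: e`_i) -> omega x0 y0 != 0 -> w = 0.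
  move=> n2; subst n => eE xyN0; set e0 := e`_0; set e1 := e`_1.
  have E v : exists c d, v = c *: e0 + d *: e1.
    exists (coord e ord0 v), (coord e (lift ord0 ord0) v).
    by rewrite {1}(eE v) !big_ord_recl big_ord0 addr0.
  have e01 : omega e0 e1 != 0.
    apply/eqP => e01_0; case/negP: xyN0; apply/eqP.
    have [c [d ->]] := E x0; have [c' [d' ->]] := E y0.
    rewrite !(omegaDl, omegaDr, omegaZl, omegaZr, omegaxx) [omega e1 e0]omegaC.
    by rewrite e01_0; ring.
  have [c [d wE]] := E w.
  move: (w0 e0) (w0 e1); rewrite wE !(omegaDl, omegaDr, omegaZl, omegaZr, omegaxx).
  rewrite !mulr0 addr0 add0r => /eqP + /eqP; rewrite [omega e1 e0]omegaC.
  rewrite !mulf_eq0 oppr_eq0 (negbTE e01) !orbF => /eqP-> /eqP->.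
  by rewrite !scale0r addr0.
apply: sumE dimL _ => v; apply: coord_vbasis; exact: memvf.
Qed.

Notation N := (@normLK K L).

Lemma omega_norm t x y : omega (t * x) (t * y) = N t * omega x y.
Proof. by rewrite /normLK -omega_lfun !lfunE. Qed.

(** Most identities for determinants, norms and polar forms are proved by multiplying with
    [omega x y], which turns them into bilinear algebra. *)
Lemma omega_eq_coef c d : (forall x y, c * omega x y = d * omega x y) -> c = d.
Proof. by move=> cd; have [x [y /mulIf]] := omega_neq0; apply. Qed.

Lemma ldet_comp (f g : 'End(L)) : ldet (f \o g)%VF = ldet f * ldet g.
Proof.
apply: omega_eq_coef => x y; rewrite -omega_lfun !lfunE /= omega_lfun omega_lfun.
by rewrite mulrA.
Qed.

Lemma ldet_id : ldet (\1%VF : 'End(L)) = 1.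
Proof. by apply: omega_eq_coef => x y; rewrite -omega_lfun !lfunE mul1r. Qed.

Lemma normM x y : N (x * y) = N x * N y.
Proof.
by apply: omega_eq_coef => u v; rewrite -omega_norm -!mulrA !omega_norm.
Qed.

Lemma norm1 : N 1 = 1.
Proof. by apply: omega_eq_coef => u v; rewrite -omega_norm !mul1r. Qed.

Lemma normZ c x : N (c *: x) = c ^+ 2 * N x.
Proof.
apply: omega_eq_coef => u v; rewrite -omega_norm -!scalerAl omegaZl omegaZr.
by rewrite omega_norm; ring.
Qed.

Lemma normX x n : N (x ^+ n) = N x ^+ n.
Proof. by elim: n => [|n IH]; rewrite ?expr0 ?norm1 // !exprS normM IH. Qed.

Definition normB x y := N (x + y) - N x - N y.
Notation B := normB.

Lemma normD x y : N (x + y) = N x + N y + B x y.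
Proof. by rewrite /normB; ring. Qed.

(** This is [omega_norm] polarized: expand [N (x + y) * omega u v] and cancel the diagonal terms. *)
Lemma omega_normB x y u v :
  B x y * omega u v = omega (x * u) (y * v) + omega (y * u) (x * v).
Proof.
rewrite /normB !mulrBl -!omega_norm !mulrDl !omegaDl !omegaDr; ring.
Qed.

Lemma normBC x y : B x y = B y x.
Proof. by rewrite /normB [y + x]addrC; ring. Qed.

Lemma normBDl x y z : B (x + y) z = B x z + B y z.
Proof.
apply: omega_eq_coef => u v; rewrite [RHS]mulrDl !omega_normB !mulrDl omegaDl omegaDr.
ring.
Qed.

Lemma normBMr x y z : B (x * z) (y * z) = B x y * N z.
Proof. by rewrite /normB -mulrDl !normM; ring. Qed.

(** With [a = x1 * conj x2] and [b = y1 * conj y2], this is the trace identity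
    [tr a * tr b = tr (a b) + tr (a conj b)]. *)
Lemma normBM x1 x2 y1 y2 :
  B x1 x2 * B y1 y2 = B (x1 * y1) (x2 * y2) + B (x1 * y2) (x2 * y1).
Proof.
apply: omega_eq_coef => u v.
rewrite [RHS]mulrDl -mulrA [B y1 y2 * _]omega_normB mulrDr !omega_normB !mulrA.
ring.
Qed.

Lemma normBxx x : B x x = 2%:R * N x.
Proof. by rewrite /normB -mulr2n -scaler_nat normZ; ring. Qed.

(** For the same [a] and [b], this is [tr (a b) * tr (a conj b) = (tr a)^2 N b + (tr b)^2 N a - 4 N
    a N b]. The terms are grouped so that each has a factor known to lie in [P] in [normB_prime]. *)
Lemma normBM_prod x1 x2 y1 y2 :
  B (x1 * y1) (x2 * y2) * B (x1 * y2) (x2 * y1) =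
  (B x1 x2 * N y1) * (B x1 x2 * N y2) + (B y1 y2 * N x1) * (B y1 y2 * N x2)
  - 4%:R * (N (x1 * y1) * N (x2 * y2)).
Proof.
have sq u v : B (u * u) (v * v) = B u v * B u v - 2%:R * N (u * v).
  by rewrite normBM [v * u]mulLC normBxx; ring.
have AC (p q r s : L) : p * q * (r * s) = p * r * (q * s).
  by rewrite -!mulrA [q * (r * s)]mulrA [q * r]mulLC !mulrA.
rewrite normBM [_ * y1 * (x1 * y2)]AC [_ * y2 * (x2 * y1)]AC [y2 * y1]mulLC.
rewrite [x1 * y1 * _]AC [x2 * y2 * _]AC [x2 * x1]mulLC.
rewrite normBMr [x1 * x2 * _]mulLC [x1 * x2 * (y2 * _)]mulLC normBMr !sq !normM.
ring.
Qed.

(** Here [B t 1] is the trace of [t]; in this form [normB_S] places it in [R] when [t] is in [S]. *)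
Definition conjL (t : L) := (B t 1) *: 1 - t.

(* Cayley-Hamilton in dimension 2. *)
Lemma mul_conjL t : t * conjL t = (N t) *: 1.
Proof.
apply: omega_inj => y; rewrite mulrBr -scalerAr mulr1 omegaDl omegaZl.
rewrite omega_normB !mul1r -[- _]scaleN1r !omegaZl mulN1r -omega_norm mulr1.
ring.
Qed.

Implicit Types (x y z t u v w k l : L) (I J M : L -> Prop) (r b c : K) (P : K -> Prop).

Lemma mulL_AC (x y z : L) : x * y * z = x * z * y.
Proof. by rewrite -!mulrA [y * z]mulLC. Qed.
Lemma mulL_CA (x y z : L) : x * (y * z) = y * (x * z).
Proof. by rewrite !mulrA [x * y]mulLC. Qed.
Lemma mulL_ACA (x y z t : L) : x * y * (z * t) = x * z * (y * t).
Proof. by rewrite -!mulrA [y * (z * t)]mulL_CA. Qed.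

Lemma exprML (x y : L) n : (x * y) ^+ n = x ^+ n * y ^+ n.
Proof. by apply: exprMn_comm; apply: mulLC. Qed.

Lemma mulL1_unit (x y : L) : x * y = 1 -> x \is a GRing.unit.
Proof. by move=> xy; apply/unitrP; exists y; rewrite [y * x]mulLC xy. Qed.

Lemma unit_norm_neq0 x : x \is a GRing.unit -> N x != 0.
Proof.
move=> ux; apply/eqP => Nx0; have := norm1; rewrite -(mulrV ux) normM Nx0 mul0r.
by move/esym/eqP; rewrite oner_eq0.
Qed.

Lemma mul_norm_conjL x : N x != 0 -> x * ((N x)^-1 *: conjL x) = 1.
Proof. by move=> NxN0; rewrite -scalerAr mul_conjL scalerA mulVf ?scale1r. Qed.

Lemma norm_neq0_unit x : N x != 0 -> x \is a GRing.unit.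
Proof. by move/mul_norm_conjL/mulL1_unit. Qed.

Lemma normV x : x \is a GRing.unit -> N x^-1 = (N x)^-1.
Proof.
move=> ux; apply: (mulfI (unit_norm_neq0 _ ux)).
by rewrite -normM mulrV // norm1 mulfV ?unit_norm_neq0.
Qed.

Let S1 : S 1. Proof. by case: quadS. Qed.
Let SB x y : S x -> S y -> S (x - y). Proof. by case: quadS => _ + _ _ _; apply. Qed.
Let SM x y : S x -> S y -> S (x * y). Proof. by case: quadS => _ _ + _ _; apply. Qed.
Let SZ r x : R r -> S x -> S (r *: x). Proof. by case: quadS => _ _ _ + _; apply. Qed.
Let latS : latticeL R S. Proof. by case: quadS. Qed.
Let S0 : S 0. Proof. by rewrite -(subrr 1); apply: SB. Qed.
Let SD x y : S x -> S y -> S (x + y).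
Proof. by move=> Sx Sy; rewrite -[y]opprK -[- y]sub0r; apply: SB => //; apply: SB. Qed.

Lemma ldet_stable (f : 'End(L)) : (forall x, S x -> S (f x)) -> R (ldet f).
Proof.
move=> Sf; have icR : integrally_closedR R by case: dedR.
apply: (multiplier_in_integrally_closed _ _ subR a) => // t.
have [_ _ _ aE] := orS; case/aE => s [Ss [c [szc Rc ->]]]; apply/aE.
exists [seq (f p.1, f p.2) | p <- s]; split.
  move=> i; case: (ltnP i (size s)) => lis.
    by rewrite (nth_map 0) //=; case: (Ss i) => *; split; apply: Sf.
  by rewrite nth_default ?size_map.
exists c; rewrite size_map; split=> //; rewrite mulr_sumr.
by apply: eq_bigr => i _; rewrite (nth_map 0) //= omega_lfun; ring.
Qed.

Lemma norm_S t : S t -> R (N t).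
Proof. by move=> St; apply: ldet_stable => x Sx; rewrite lfunE; apply: SM. Qed.

Lemma normB_S x y : S x -> S y -> R (B x y).
Proof.
by move=> Sx Sy; do !apply: subringKB => //; apply: norm_S => //; apply: SD.
Qed.

Lemma conjL_S t : S t -> S (conjL t).
Proof. by move=> St; apply: SB => //; apply: SZ => //; apply: normB_S. Qed.

(** * Products of lattices *)

Definition Rsubmod (M : L -> Prop) :=
  [/\ M 0, forall x y, M x -> M y -> M (x + y)
    & forall r x, R r -> M x -> M (r *: x)].

(** Only the closure properties of a fractional ideal are kept: they suffice for the identities
    between products and are inherited without any finiteness argument. *)
Definition Smod (M : L -> Prop) := Rsubmod M /\ forall x y, S x -> M y -> M (x * y).

Lemma set_eqE (T : Type) (A B : T -> Prop) : set_eq A B -> A = B.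
Proof. by move=> AB; apply: boolp.funext => x; apply: boolp.propext. Qed.

(** Coefficients given by a function on [nat] add and scale without matching lengths. *)
Lemma RspanLP (s : seq L) v : RspanL R s v <->
  exists c : nat -> K, (forall i, R (c i)) /\ v = \sum_(i < size s) c i *: s`_i.
Proof.
split=> [[c [_ Rc ->]]|[c [Rc ->]]]; first by exists (nth 0 c).
exists (mkseq c (size s)); rewrite size_mkseq; split=> //.
  move=> i; case: (ltnP i (size s)) => lis; first by rewrite nth_mkseq.
  by rewrite nth_default ?size_mkseq //; apply: subringK0.
by apply: eq_bigr => i _; rewrite nth_mkseq.
Qed.

Lemma RspanL_submod s : Rsubmod (RspanL R s).
Proof.
split.
- apply/RspanLP; exists (fun=> 0); split=> [_|]; first exact: subringK0.
  by rewrite big1 // => i _; rewrite scale0r.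
- move=> _ _ /RspanLP[c [Rc ->]] /RspanLP[d [Rd ->]]; apply/RspanLP.
  exists (fun i => c i + d i); split=> [i|]; first exact: subringKD.
  by rewrite -big_split; apply: eq_bigr => i _; rewrite scalerDl.
- move=> r _ Rr /RspanLP[c [Rc ->]]; apply/RspanLP.
  exists (fun i => r * c i); split=> [i|]; first exact: subringKM.
  by rewrite scaler_sumr; apply: eq_bigr => i _; rewrite scalerA.
Qed.

Lemma RspanL_mem (s : seq L) x : x \in s -> RspanL R s x.
Proof.
move=> xs; apply/RspanLP; exists (fun i => (i == index x s)%:R); split.
  by move=> i; case: (i == _); [apply: subringK1 | apply: subringK0].
move: (xs); rewrite -index_mem => li; rewrite (bigD1 (Ordinal li)) //= eqxx scale1r.
rewrite nth_index // big1 ?addr0 // => i iN.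
by rewrite (negbTE (iN : (i : nat) != index x s)) scale0r.
Qed.

Lemma RspanL_sub s M : Rsubmod M -> (forall x, x \in s -> M x) ->
  forall v, RspanL R s v -> M v.
Proof.
move=> [M0 MD MZ] Ms _ /RspanLP[c [Rc ->]]; apply: (big_ind M) => // i _.
by apply: MZ => //; apply: Ms; apply: mem_nth.
Qed.

Lemma latticeL_submod M : latticeL R M -> Rsubmod M.
Proof. by move=> [s [/set_eqE-> _]]; apply: RspanL_submod. Qed.

Lemma frac_idealS_Smod I : frac_idealS R S I -> Smod I.
Proof. by move=> [latI SI]; split=> //; apply: latticeL_submod. Qed.

Lemma Smod_S : Smod S. Proof. by []. Qed.

Lemma prodL_cons I J x y v : I x -> J y -> prodL I J v -> prodL I J (x * y + v).
Proof.
move=> Ix Jy [s [sIJ ->]]; exists ((x, y) :: s); split=> [[]//|].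
by rewrite big_ord_recl.
Qed.

(** Induction on the number of summands, so that later arguments never handle sequences of pairs. *)
Lemma prodL_ind I J (Q : L -> Prop) : Q 0 ->
  (forall x y v, I x -> J y -> Q v -> Q (x * y + v)) -> forall v, prodL I J v -> Q v.
Proof.
move=> Q0 Qc _ [s [+ ->]]; elim: s => [|p s IH] sIJ; first by rewrite big_ord0.
rewrite big_ord_recl; case: (sIJ 0%N) => /= *; apply: Qc => //.
by apply: IH => i; apply: (sIJ i.+1).
Qed.

Lemma prodL_submod I J : Rsubmod I -> Rsubmod J -> Rsubmod (prodL I J).
Proof.
move=> [I0 _ _] [J0 _ JZ].
have P0 : prodL I J 0 by exists [::]; split=> [i|]; rewrite ?nth_nil ?big_ord0.
split=> // [x y Px Py|r x Rr].
  apply: (prodL_ind _ _ (fun x => prodL I J (x + y))) Px => [|u v w Iu Jv].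
    by rewrite add0r.
  by rewrite -addrA; apply: prodL_cons.
apply: (prodL_ind _ _ (fun x => prodL I J (r *: x))) => [|u v w Iu Jv].
  by rewrite scaler0.
by rewrite scalerDr scalerAr; apply: prodL_cons => //; apply: JZ.
Qed.

Lemma prodL_mem I J x y : Rsubmod I -> Rsubmod J -> I x -> J y -> prodL I J (x * y).
Proof.
move=> mI mJ Ix Jy; rewrite -[x * y]addr0; apply: prodL_cons => //.
by case: (prodL_submod _ _ mI mJ).
Qed.

Lemma prodL_sub I J M : Rsubmod M -> (forall x y, I x -> J y -> M (x * y)) ->
  forall v, prodL I J v -> M v.
Proof.
move=> [M0 MD _] IJM; apply: prodL_ind => // x y v Ix Jy Mv.
by apply: MD => //; apply: IJM.
Qed.

Lemma prodL_Smod I J : Smod I -> Smod J -> Smod (prodL I J).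
Proof.
move=> [mI SI] [mJ SJ]; have mP := prodL_submod _ _ mI mJ; split=> // x y Sx.
apply: (prodL_ind _ _ (fun y => prodL I J (x * y))) => [|u v w Iu Jv Pw].
  by rewrite mulr0; case: mP.
by rewrite mulrDr mulrA; apply: prodL_cons => //; apply: SI.
Qed.

Lemma cubeL_Smod I : Smod I -> Smod (cubeL I).
Proof. by move=> mI; apply: prodL_Smod => //; apply: prodL_Smod. Qed.

Lemma scaleL_Smod k I : Smod I -> Smod (scaleL k I).
Proof.
move=> [[I0 ID IZ] SI]; split; first split.
- by exists 0; rewrite mulr0.
- by move=> _ _ [x [Ix ->]] [y [Iy ->]]; exists (x + y); rewrite mulrDr; split=> //; apply: ID.
- by move=> r _ Rr [x [Ix ->]]; exists (r *: x); rewrite scalerAr; split=> //; apply: IZ.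
- by move=> x _ Sx [y [Iy ->]]; exists (x * y); rewrite mulL_CA; split=> //; apply: SI.
Qed.

Lemma prodLC I J : Smod I -> Smod J -> prodL I J = prodL J I.
Proof.
move=> [mI _] [mJ _]; apply: set_eqE => v; split; apply: prodL_sub.
all: try exact: prodL_submod.
all: by move=> x y Ix Jy; rewrite mulLC; apply: prodL_mem.
Qed.

Lemma prodLA I J M : Smod I -> Smod J -> Smod M ->
  prodL I (prodL J M) = prodL (prodL I J) M.
Proof.
move=> [mI _] [mJ _] [mM _].
have mIJ := prodL_submod _ _ mI mJ; have mJM := prodL_submod _ _ mJ mM.
have mIJM := prodL_submod _ _ mIJ mM; have mI_JM := prodL_submod _ _ mI mJM.
apply: set_eqE => v; split; apply: prodL_sub => // x y.
  move=> Ix; apply: (prodL_ind _ _ (fun y => prodL (prodL I J) M (x * y))).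
    by rewrite mulr0; case: mIJM.
  move=> z t w Jz Mt; rewrite mulrDr mulrA; apply: prodL_cons => //.
  exact: prodL_mem.
move=> + My; apply: (prodL_ind _ _ (fun x => prodL I (prodL J M) (x * y))).
  by rewrite mul0r; case: mI_JM.
move=> z t w Iz Jt; rewrite mulrDl -mulrA; apply: prodL_cons => //.
exact: prodL_mem.
Qed.

Lemma prodLACA I J I' J' : Smod I -> Smod J -> Smod I' -> Smod J' ->
  prodL (prodL I J) (prodL I' J') = prodL (prodL I I') (prodL J J').
Proof.
move=> mI mJ mI' mJ'; rewrite -!prodLA //; try exact: prodL_Smod.
by congr (prodL I _); rewrite prodLA // [prodL J I']prodLC // -prodLA.
Qed.

Lemma prodL_scale k l I J : Smod I -> Smod J ->
  prodL (scaleL k I) (scaleL l J) = scaleL (k * l) (prodL I J).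
Proof.
move=> mI mJ; have [mP _] := scaleL_Smod (k * l) _ (prodL_Smod _ _ mI mJ).
have [mQ _] := prodL_Smod _ _ (scaleL_Smod k _ mI) (scaleL_Smod l _ mJ).
apply: set_eqE => v; split.
  apply: prodL_sub => // _ _ [x [Ix ->]] [y [Jy ->]]; exists (x * y).
  by rewrite mulL_ACA; split=> //; apply: prodL_mem => //; [case: mI | case: mJ].
move=> [w [+ ->]].
apply: (prodL_ind _ _ (fun w => prodL (scaleL k I) (scaleL l J) (k * l * w))).
  by rewrite mulr0; case: mQ.
move=> x y t Ix Jy; rewrite mulrDr mulL_ACA.
by apply: prodL_cons; [exists x | exists y].
Qed.

Lemma scaleLM k l I : scaleL k (scaleL l I) = scaleL (k * l) I.
Proof.
apply: set_eqE => v; split=> [[_ [[w [Iw ->]] ->]]|[w [Iw ->]]].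
  by exists w; rewrite mulrA.
by exists (l * w); rewrite mulrA; split=> //; exists w.
Qed.

Lemma prodSL I : Smod I -> prodL S I = I.
Proof.
move=> [mI SI]; apply: set_eqE => v; split; first exact: prodL_sub.
by move=> Iv; rewrite -[v]mul1r; apply: prodL_mem.
Qed.

Lemma scaleL_unitS u : S u -> S u^-1 -> u \is a GRing.unit -> scaleL u S = S.
Proof.
move=> Su SVu uu; apply: set_eqE => v; split=> [[w [Sw ->]]|Sv]; first exact: SM.
by exists (u^-1 * v); rewrite mulrA mulrV // mul1r; split=> //; apply: SM.
Qed.

(** The pairwise products of generators generate [prodL I J], and they span [L] because [u J]
    already does, [u] being invertible. *)
Lemma latticeL_prod I J u : latticeL R I -> latticeL R J -> I u ->
  u \is a GRing.unit -> latticeL R (prodL I J).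
Proof.
move=> latI latJ Iu uu.
have mI := latticeL_submod _ latI; have mJ := latticeL_submod _ latJ.
have [s [sI _]] := latI; have [t [tJ fullt]] := latJ.
pose p := [seq x * y | x <- s, y <- t].
have st_p x y : x \in s -> y \in t -> x * y \in p by move=> *; apply: allpairs_f.
exists p; split.
  have mp := RspanL_submod p; have [p0 pD pZ] := mp.
  move=> v; split.
    apply: prodL_sub => // x y /sI sx /tJ ty.
    apply: (RspanL_sub s (fun x => RspanL R p (x * y))) sx => [|{}x xs].
      split=> [|x1 x2|r z Rr]; rewrite ?mul0r ?mulrDl -?scalerAl //.
        exact: pD.
      exact: pZ.
    apply: (RspanL_sub t (fun y => RspanL R p (x * y))) ty => [|{}y yt].
      split=> [|x1 x2|r z Rr]; rewrite ?mulr0 ?mulrDr -?scalerAr //.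
        exact: pD.
      exact: pZ.
    by apply: RspanL_mem; apply: st_p.
  apply: RspanL_sub; first exact: prodL_submod.
  move=> _ /allpairsP[[x y] [xs yt ->]] /=.
  by apply: prodL_mem => //; [apply/sI | apply/tJ]; apply: RspanL_mem.
apply/vspaceP => v; rewrite memvf.
have : (<<t>> <= amull u @^-1: <<p>>)%VS.
  apply/span_subvP => y yt; rewrite -memv_preim lfunE.
  move/sI: Iu => /RspanLP[c [_ ->]]; rewrite /= mulr_suml rpred_sum // => i _.
  by rewrite -scalerAl rpredZ // memv_span // st_p // mem_nth.
rewrite fullt => /subvP/(_ (u^-1 * v) (memvf _)).
by rewrite -memv_preim lfunE /= mulrA mulrV // mul1r.
Qed.

(** * Local generators and the module index *)

(** Same ideal of denominators as in [mem_of_local], now for a vector. *)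
Lemma submod_mem_of_local M v : Rsubmod M ->
  (forall P, prime_idealR R P -> exists b, [/\ R b, ~ P b & M (b *: v)]) -> M v.
Proof.
move=> [M0 MD MZ] loc.
suff : (fun b => R b /\ M (b *: v)) 1 by rewrite scale1r => -[].
apply: (ideal_not_in_primes _ _ subR (fun b => R b /\ M (b *: v))); last first.
  by move=> P /loc[b []]; exists b.
split=> [b []//||b c [Rb Mb] [Rc Mc]|r b Rr [Rb Mb]].
- by rewrite scale0r; split=> //; apply: subringK0.
- by rewrite scalerDl; split; [apply: subringKD | apply: MD].
- by rewrite -scalerA; split; [apply: subringKM | apply: MZ].
Qed.

(** * Existence of local generators *)

Section NonunitProducts.
Variables (P : K -> Prop) (I J : L -> Prop).
Hypothesis primeP : prime_idealR R P.
Hypothesis ID : forall x y, I x -> I y -> I (x + y).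
Hypothesis JD : forall x y, J x -> J y -> J (x + y).
Hypothesis IJS : forall x y, I x -> J y -> S (x * y).
Hypothesis PN : forall x y, I x -> J y -> P (N (x * y)).

Let PD c d : P c -> P d -> P (c + d).
Proof. by have [[_ _ + _] _ _] := primeP; apply. Qed.
Let PM r c : R r -> P c -> P (r * c).
Proof. by have [[_ _ _ +] _ _] := primeP; apply. Qed.
Let PR c : P c -> R c.
Proof. by have [[+ _ _ _] _ _] := primeP; apply. Qed.
Let PB c d : P c -> P d -> P (c - d).
Proof. by move=> Pc Pd; apply: (prime_idealB _ _ subR). Qed.

Lemma normB_norm_prime x1 x2 y : I x1 -> I x2 -> J y -> P (B x1 x2 * N y).
Proof.
move=> I1 I2 Jy; rewrite -normBMr /normB -mulrDl.
by apply: PB; [apply: PB|]; apply: PN => //; apply: ID.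
Qed.

Lemma norm_normB_prime x y1 y2 : I x -> J y1 -> J y2 -> P (B y1 y2 * N x).
Proof.
move=> Ix J1 J2; rewrite -normBMr ![_ * x]mulLC /normB -mulrDr.
by apply: PB; [apply: PB|]; apply: PN => //; apply: JD.
Qed.

(* The two summands of [B x1 x2 * B y1 y2] have their sum and product in [P]. *)
Lemma normB_prime x1 x2 y1 y2 : I x1 -> I x2 -> J y1 -> J y2 ->
  P (B (x1 * y1) (x2 * y2)).
Proof.
move=> I1 I2 J1 J2.
have Ps : P (B x1 x2 * B y1 y2).
  rewrite {2}/normB !mulrBr.
  by apply: PB; [apply: PB|]; apply: normB_norm_prime => //; apply: JD.
have Rb x y x' y' : I x -> J y -> I x' -> J y' -> R (B (x * y) (x' * y')).
  by move=> *; apply: normB_S; apply: IJS.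
have [_ _ Pprime] := primeP.
case: (Pprime (B (x1 * y1) (x2 * y2)) (B (x1 * y2) (x2 * y1))) => //.
- exact: Rb.
- exact: Rb.
- rewrite normBM_prod; apply: PB; [apply: PD|].
  + by apply: PM; [apply: PR|]; apply: normB_norm_prime.
  + by apply: PM; [apply: PR|]; apply: norm_normB_prime.
  + apply: PM; last by apply: PM; [apply: PR|]; apply: PN.
    (* The constant [4] unfolds to [1 + (1 + (1 + 1))]. *)
    by do 3!(apply: (subringKD _ _ subR 1); first exact: subringK1); apply: subringK1.
by move=> Pb2; move: Ps; rewrite normBM => /PB/(_ Pb2); rewrite addrK.
Qed.

Lemma norm_prodL_prime v : prodL I J v -> P (N v).
Proof.
have P0 : P 0 by have [[]] := primeP.
have N0 : N 0 = 0 by rewrite -(scale0r 0) normZ expr0n mul0r.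
have B0 x : B 0 x = 0 by rewrite /normB add0r N0 subr0 subrr.
(* The induction has to carry the polar form as well, since adding [x * y] to [w] changes [N w] by
   [N (x * y) + B (x * y) w]. *)
move=> Pv; suff [] : P (N v) /\ forall x y, I x -> J y -> P (B v (x * y)) by [].
move: Pv; apply: (prodL_ind I J (fun v => P (N v) /\
  forall x y, I x -> J y -> P (B v (x * y)))) => [|x y w Ix Jy [PNw PBw]].
  by rewrite N0; split=> // x y _ _; rewrite B0.
split=> [|x' y' Ix' Jy'].
  by rewrite normD normBC; apply: PD; [apply: PD => //; apply: PN | apply: PBw].
by rewrite normBDl; apply: PD; [apply: normB_prime | apply: PBw].
Qed.

End NonunitProducts.

(* [x] generates [I] locally at [P], with [y] a local inverse witnessing it. *)
Definition locgen P I x :=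
  exists y, [/\ I x, forall i, I i -> S (i * y) & ~ P (N (x * y))].

Lemma invertible_locgen I P : invertibleS R S I -> prime_idealR R P ->
  exists x, locgen P I x.
Proof.
move=> [fI [J [fJ /set_eqE IJ]]] prP; apply: boolp.contrapT => no.
have [[I0 ID IZ] SI] := frac_idealS_Smod _ fI.
have [[J0 JD JZ] SJ] := frac_idealS_Smod _ fJ.
have IJS x y : I x -> J y -> S (x * y) by move=> *; rewrite -IJ; apply: prodL_mem.
have [_ PN1 _] := prP; apply: PN1; rewrite -norm1.
apply: (norm_prodL_prime P I J prP ID JD IJS); last by rewrite IJ.
move=> x y Ix Jy; apply: boolp.contrapT => nP; apply: no; exists x, y; split=> //.
by move=> i Ii; apply: IJS.
Qed.

Lemma locgen_unit P I x : prime_idealR R P -> locgen P I x -> x \is a GRing.unit.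
Proof.
move=> prP [y [_ _ /(prime_notin_neq0 _ _ _ _ prP)]]; rewrite normM mulf_eq0 negb_or.
by move=> /andP[/norm_neq0_unit].
Qed.

Lemma locgen_prod P I J x y : prime_idealR R P -> Smod I -> Smod J ->
  locgen P I x -> locgen P J y -> locgen P (prodL I J) (x * y).
Proof.
move=> prP [mI _] [mJ _] [x' [Ix Sx' nPx]] [y' [Jy Sy' nPy]]; exists (x' * y'); split.
- exact: prodL_mem.
- apply: (prodL_sub _ _ (fun i => S (i * (x' * y')))).
    split=> [|i j|r i Rr]; rewrite ?mul0r ?mulrDl -?scalerAl //; first exact: SD.
    exact: SZ.
  by move=> i j Ii Jj; rewrite mulL_ACA; apply: SM; [apply: Sx' | apply: Sy'].
- rewrite mulL_ACA normM; apply: (prime_mulN _ _ _ _ _ prP) => //.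
  + by apply: norm_S; apply: Sx'.
  + by apply: norm_S; apply: Sy'.
Qed.

Lemma locgen_cube P I x : prime_idealR R P -> Smod I ->
  locgen P I x -> locgen P (cubeL I) (x ^+ 3).
Proof.
move=> prP mI gx; rewrite exprSr expr2.
apply: locgen_prod => //; first exact: prodL_Smod.
exact: locgen_prod.
Qed.

Lemma locgen_scale P k : prime_idealR R P -> k \is a GRing.unit ->
  locgen P (scaleL k S) k.
Proof.
move=> prP uk; exists k^-1; split; first by exists 1; rewrite mulr1.
  by move=> _ [x [Sx ->]]; rewrite mulL_AC mulrV // mul1r.
by rewrite mulrV // norm1; case: prP.
Qed.

(** With [y] the local inverse, [i = x * (i * y * conjL (x * y)) / N (x * y)] for [i] in [I], and
    the denominator is outside [P]. *)
Lemma locgenE P I x : prime_idealR R P -> Smod I -> locgen P I x ->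
  locL R P I = scaleL x (locL R P S).
Proof.
move=> prP [[_ _ IZ] SI] gx; have ux := locgen_unit _ _ _ prP gx.
case: gx => y [Ix Sy nP].
have RN : R (N (x * y)) by apply: norm_S; apply: Sy.
apply: set_eqE => v; split.
  move=> [i [b [Ii Rb nPb ->]]].
  exists (b^-1 *: ((N (x * y))^-1 *: (i * y * conjL (x * y)))); split.
    exists (i * y * conjL (x * y)), (b * N (x * y)); split.
    - by apply: SM; [apply: Sy | apply: conjL_S; apply: Sy].
    - exact: subringKM.
    - exact: (prime_mulN _ _ _ _ _ prP).
    - by rewrite scalerA invfM.
  rewrite -!scalerAr; congr (_ *: _).
  rewrite mulrA mulL_CA -mulrA [x * y * _]mul_conjL -scalerAr mulr1 scalerA.
  by rewrite mulVf ?scale1r // (prime_notin_neq0 _ _ _ _ prP).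
move=> [_ [[s [b [Ss Rb nPb ->]]] ->]]; exists (s * x), b; split=> //.
  exact: SI.
by rewrite -scalerAr mulLC.
Qed.

(* [c] lies in [d R_P]. *)
Definition locdvd P d c := exists b r, [/\ R b, ~ P b, R r & b * c = r * d].

Lemma locdvd_refl P d : prime_idealR R P -> locdvd P d d.
Proof.
by move=> [_ ? _]; exists 1, 1; split=> //; apply: subringK1.
Qed.

Lemma locdvd_trans P e d c : prime_idealR R P ->
  locdvd P e d -> locdvd P d c -> locdvd P e c.
Proof.
move=> prP [b [r [Rb nPb Rr E]]] [b' [r' [Rb' nPb' Rr' E']]].
exists (b * b'), (r' * r); split; try exact: subringKM; first exact: (prime_mulN _ _ _ _ _ prP).
by rewrite -!mulrA -E E'; ring.
Qed.

Lemma locdvd_mul P d c d' c' : prime_idealR R P ->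
  locdvd P d c -> locdvd P d' c' -> locdvd P (d * d') (c * c').
Proof.
move=> prP [b [r [Rb nPb Rr E]]] [b' [r' [Rb' nPb' Rr' E']]].
exists (b * b'), (r * r'); split; try exact: subringKM; first exact: (prime_mulN _ _ _ _ _ prP).
by rewrite mulrACA E E'; ring.
Qed.

Lemma locdvd_exp P d c n : prime_idealR R P ->
  locdvd P d c -> locdvd P (d ^+ n) (c ^+ n).
Proof.
move=> prP dc; elim: n => [|n IH]; first by rewrite !expr0; apply: locdvd_refl.
by rewrite !exprS; apply: locdvd_mul.
Qed.

Lemma locdvd_global c d : d != 0 -> (forall P, prime_idealR R P -> locdvd P d c) ->
  R (c / d).
Proof.
move=> dN0 loc; apply: mem_of_local => // P /loc[b [r [Rb nPb Rr E]]].
by exists b; rewrite mulrA E mulfK.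
Qed.

Lemma locdvd_locK P c d : prime_idealR R P -> locdvd P d c ->
  forall x : K, locK R P (principalR R c) x -> exists r, locK R P R r /\ x = d * r.
Proof.
move=> prP [b [r [Rb nPb Rr E]]] _ [_ [b' [[r' [Rr' ->]] Rb' nPb' ->]]].
have bN0 := prime_notin_neq0 _ _ _ _ prP nPb.
have b'N0 := prime_notin_neq0 _ _ _ _ prP nPb'.
have -> : c = r * d / b by rewrite -E mulrC mulKf.
exists (r * r' / (b * b')); split; last by field; rewrite bN0 b'N0.
exists (r * r'), (b * b'); split=> //; try exact: subringKM.
exact: (prime_mulN _ _ _ _ _ prP).
Qed.

Lemma locK_locdvd P c d : prime_idealR R P -> locdvd P c d ->
  forall x : K, (exists r, locK R P R r /\ x = d * r) -> locK R P (principalR R c) x.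
Proof.
move=> prP [b [r [Rb nPb Rr E]]] _ [_ [[r' [b' [Rr' Rb' nPb' ->]]] ->]].
have bN0 := prime_notin_neq0 _ _ _ _ prP nPb.
have b'N0 := prime_notin_neq0 _ _ _ _ prP nPb'.
have -> : d = r * c / b by rewrite -E mulrC mulKf.
exists (c * (r * r')), (b * b'); split; last by field; rewrite bN0 b'N0.
- by exists (r * r'); split=> //; apply: subringKM.
- exact: subringKM.
- exact: (prime_mulN _ _ _ _ _ prP).
Qed.

(** Multiplication by [x] carries [S] onto [I] locally at [P] and has determinant [N x], so the
    index may be tested on it. *)
Lemma index_is_locdvd P I c x : Smod I -> index_is R S I (principalR R c) ->
  prime_idealR R P -> locgen P I x -> locdvd P (N x) c /\ locdvd P c (N x).
Proof.
move=> mI idx prP gx; have [_ nP1 _] := prP; have R1 := subringK1 _ _ subR.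
have {}idx : set_eq (locK R P (principalR R c))
    (fun t : K => exists r, locK R P R r /\ t = N x * r).
  apply: idx => //; rewrite (locgenE _ _ _ prP mI gx) => v.
  by split=> [[w [Sw ->]]|[w [Sw <-]]]; exists w; rewrite lfunE.
split.
  have [] := (idx c).1.
    by exists c, 1; split=> //; [exists 1; rewrite mulr1 | rewrite divr1].
  move=> _ [[r [b [Rr Rb nPb ->]]] E]; exists b, r; split=> //.
  have bN0 := prime_notin_neq0 _ _ _ _ prP nPb.
  by rewrite {1}E; field.
have [] := (idx (N x)).2.
  by exists 1; rewrite mulr1; split=> //; exists 1, 1; split=> //; rewrite divr1.
move=> _ [b [[r [Rr ->]] Rb nPb E]]; exists b, r; split=> //.
have bN0 := prime_notin_neq0 _ _ _ _ prP nPb.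
by rewrite {1}E; field.
Qed.

(** As [S] is finitely generated, the product of one denominator per generator works. *)
Lemma clear_denominators P (f : 'End(L)) : prime_idealR R P ->
  (forall v, S v -> locL R P S (f v)) ->
  exists b, [/\ R b, ~ P b & forall v, S v -> S (b *: f v)].
Proof.
move=> prP Sf; have [s [/set_eqE sS _]] := latS.
have {Sf}: forall v, v \in s -> locL R P S (f v).
  by move=> v vs; apply: Sf; rewrite sS; apply: RspanL_mem.
suff H : (forall v, v \in s -> locL R P S (f v)) ->
    exists b, [/\ R b, ~ P b & forall v, v \in s -> S (b *: f v)].
  move=> /H[b [Rb nPb bs]]; exists b; split=> // v; rewrite [S in S v]sS.
  apply: (RspanL_sub s (fun v => S (b *: f v))) => //.
  split=> [|x y|r x Rr]; rewrite ?linear0 ?scaler0 //.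
    by rewrite linearD scalerDr; apply: SD.
  by rewrite linearZ /= scalerA mulrC -scalerA; apply: SZ.
elim: {sS}s => [|x s IH] sf.
  by exists 1; split=> //; [apply: subringK1 | case: prP].
have [|b [Rb nPb bs]] := IH; first by move=> v vs; apply: sf; rewrite inE vs orbT.
have [m [b' [Sm Rb' nPb' E]]] := sf x (mem_head _ _).
exists (b * b'); split; [exact: subringKM | exact: (prime_mulN _ _ _ _ _ prP) | move=> v].
rewrite inE => /predU1P[->|vs].
  rewrite E scalerA -mulrA divff ?mulr1; first exact: SZ.
  exact: (prime_notin_neq0 _ _ _ _ prP).
by rewrite mulrC -scalerA; apply: SZ => //; apply: bs.
Qed.

Lemma ldet_locally_stable P (f : 'End(L)) : prime_idealR R P ->
  (forall v, S v -> locL R P S (f v)) -> locdvd P 1 (ldet f).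
Proof.
move=> prP /(clear_denominators _ _ prP)[b [Rb nPb bf]].
(* In rank 2, scaling [f] by [b] multiplies the determinant by [b * b]. *)
exists (b * b), (b * b * ldet f); rewrite mulr1; split=> //.
- exact: subringKM.
- exact: (prime_mulN _ _ _ _ _ prP).
have -> : b * b * ldet f = ldet (b *: f).
  apply: omega_eq_coef => x y; rewrite -[RHS]omega_lfun !lfunE /= omegaZl omegaZr.
  by rewrite omega_lfun; ring.
by apply: ldet_stable => x Sx; rewrite lfunE; apply: bf.
Qed.

Lemma S_locL P x : prime_idealR R P -> S x -> locL R P S x.
Proof.
move=> [_ nP1 _] Sx; exists x, 1; split=> //; first exact: subringK1.
by rewrite invr1 scale1r.
Qed.

(** The index condition ranges over all [phi], so each is compared with multiplication by [x]:
    following [phi] by [x^-1], or [x] by [phi^-1], preserves [S] at [P], hence [ldet phi] and [N x]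
    differ by a unit there. *)
Lemma locdvd_index_is I c : Smod I ->
  (forall P, prime_idealR R P -> exists x,
     [/\ locgen P I x, locdvd P (N x) c & locdvd P c (N x)]) ->
  index_is R S I (principalR R c).
Proof.
move=> mI loc P prP phi phiE.
have [x [gx xc cx]] := loc _ prP; have ux := locgen_unit _ _ _ prP gx.
rewrite (locgenE _ _ _ prP mI gx) in phiE.
have phi_x : locdvd P (N x) (ldet phi).
  have := ldet_locally_stable P (amull (x^-1)%R \o phi)%VF prP.
  rewrite ldet_comp -/(N x^-1) normV // => /(_ _)[|b [r [Rb nPb Rr E]]].
    move=> v Sv; rewrite !lfunE /=; rewrite lfunE /=.
    have /phiE[w [Sw ->]] : exists w, locL R P S w /\ phi w = phi v.
      by exists v; split=> //; apply: S_locL.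
    by rewrite mulrA mulVr // mul1r.
  exists b, r; split=> //; move: E; rewrite mulr1 => <-.
  by field; rewrite unit_norm_neq0.
have x_phi : locdvd P (ldet phi) (N x).
  (* The image contains [x S], which spans [L], so [phi] is bijective and [phi^-1] is a true
     inverse. *)
  have full : limg phi = fullv.
    have [s [/set_eqE sS fulls]] := latS.
    apply/vspaceP => v; rewrite memvf.
    have : (<<s>> <= amull x @^-1: limg phi)%VS.
      apply/span_subvP => y ys; rewrite -memv_preim lfunE /=.
      have /phiE[w [_ <-]] : scaleL x (locL R P S) (x * y).
        by exists y; split=> //; apply: S_locL => //; rewrite sS; apply: RspanL_mem.
      by rewrite memv_img ?memvf.
    rewrite fulls => /subvP/(_ (x^-1 * v) (memvf _)).
    by rewrite -memv_preim lfunE /= mulrA mulrV // mul1r.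
  have ker0 : lker phi == 0%VS.
    have := limg_ker_dim phi fullv; rewrite full capfv => /eqP.
    by rewrite -[X in _ == X]add0n eqn_add2r dimv_eq0.
  have := ldet_locally_stable P (phi^-1 \o amull x)%VF prP.
  rewrite ldet_comp -/(N x) => /(_ _)[|b [r [Rb nPb Rr E]]].
    move=> v Sv; rewrite !lfunE /= lfunE /=.
    have /phiE[w [Sw <-]] : scaleL x (locL R P S) (x * v).
      by exists v; split=> //; apply: S_locL.
    by rewrite lker0_lfunK.
  have phiV : ldet phi * ldet (phi^-1)%VF = 1.
    rewrite -ldet_comp -ldet_id; congr ldet; apply/lfunP => v.
    by rewrite !lfunE /= limg_lfunVK // full memvf.
  exists b, r; split=> //; move: E; rewrite mulr1 => <-.
  by rewrite -[LHS]mulr1 -phiV; ring.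
move=> t; split; [apply: locdvd_locK | apply: locK_locdvd] => //.
  exact: (locdvd_trans _ _ _ _ prP x_phi xc).
exact: (locdvd_trans _ _ _ _ prP cx phi_x).
Qed.

(** * Balanced quadruples *)

Implicit Types q : quad L.

Lemma inQ_Smod q : inQ R S q -> Smod q.1.1.
Proof. by move=> [_ [/frac_idealS_Smod]]. Qed.

Lemma cubeL_mem I x : Rsubmod I -> I x -> cubeL I (x ^+ 3).
Proof.
move=> mI Ix; rewrite exprSr expr2.
by apply: prodL_mem => //; [apply: prodL_submod | apply: prodL_mem].
Qed.

Lemma cubeL_scale k : cubeL (scaleL k S) = scaleL (k ^+ 3) S.
Proof.
rewrite /cubeL !prodL_scale ?prodSL //; first by rewrite exprSr expr2.
all: exact: Smod_S.
Qed.

(** For a local generator [x] of [I], [x ^+ 3 = delta * t] with [t] in [S]; the index condition and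
    [s ^+ 3 = N delta] make [N t] a unit at [P], so [t] is invertible there. *)
Lemma balanced_cube q : inQ R S q -> cubeL q.1.1 = scaleL q.1.2 S.
Proof.
move=> Qq; have mI := inQ_Smod _ Qq; case: q mI Qq => [[I d] s] /= mI.
move=> [[/= fI ud sN0 cub [idx sd]] invI].
apply: set_eqE => v; split; first exact: cub.
move=> [w [Sw ->]].
have [mC SC] := cubeL_Smod _ mI; apply: submod_mem_of_local => // P prP.
have [x gx] := invertible_locgen _ _ invI prP.
have [[b [r [Rb nPb Rr E]]] _] := index_is_locdvd _ _ _ _ mI idx prP gx.
have Ix : I x by case: gx => y [].
have [mIr _] := mI.
have [t [St xt]] := cub _ (cubeL_mem _ _ mIr Ix).
have Nt : s ^+ 3 * N t = N x ^+ 3 by rewrite sd -normM -xt normX.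
exists (b ^+ 3); split; first exact: subringKX.
  rewrite exprSr expr2; apply: (prime_mulN _ _ _ _ _ prP) => //; first exact: subringKM.
  exact: (prime_mulN _ _ _ _ _ prP).
have -> : b ^+ 3 = r ^+ 3 * N t.
  apply: (mulfI (expf_neq0 3 sN0)); rewrite [RHS]mulrCA Nt -[RHS]exprMn -E; ring.
(* This is [d * N t = x ^+ 3 * conjL t], obtained by multiplying [x ^+ 3 = d * t] by [conjL t]. *)
have -> : (r ^+ 3 * N t) *: (d * w) = r ^+ 3 *: (conjL t * w * x ^+ 3).
  rewrite -scalerA; congr (_ *: _); rewrite xt -[d * w]mul1r scalerAl -mul_conjL.
  by ringL.
case: mC => _ _ CZ; apply: CZ; first exact: subringKX.
apply: SC; first by apply: SM => //; apply: conjL_S.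
exact: cubeL_mem.
Qed.

(** Since [k] generates [k S] at every prime, the local comparisons of [c] with [N k] glue by
    [locdvd_global]. *)
Lemma index_is_scale k c : k \is a GRing.unit -> c != 0 ->
  index_is R S (scaleL k S) (principalR R c) -> R (c / N k) /\ R (N k / c).
Proof.
move=> uk cN0 idx.
have loc P (prP : prime_idealR R P) := index_is_locdvd _ _ _ _
  (scaleL_Smod k _ Smod_S) idx prP (locgen_scale _ _ prP uk).
split; last by apply: locdvd_global => // P /loc[].
by apply: locdvd_global => [|P /loc[]//]; apply: unit_norm_neq0.
Qed.

Lemma unitN1_inv u : unitN1 S u -> u \is a GRing.unit /\ unitN1 S u^-1.
Proof.
move=> [Su [v [Sv uv]] Nu]; have uu := mulL1_unit _ _ uv; split=> //.
have -> : u^-1 = v by rewrite -[u^-1]mulr1 -uv mulKr.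
split=> //; first by exists u; rewrite mulLC.
by rewrite -[LHS]mul1r -Nu -normM uv norm1.
Qed.

Lemma unitN1_of_inv u v : S u -> S v -> u * v = 1 -> N u = 1 -> unitN1 S u.
Proof. by move=> *; split=> //; exists v. Qed.

(** * Normalized generators and the kernel *)

Definition generates q k :=
  [/\ k \is a GRing.unit, q.1.1 = scaleL k S & N k = q.2].

Lemma scaleS_mem k l : scaleL k S = scaleL l S -> l \is a GRing.unit -> S (l^-1 * k).
Proof.
move=> kl ul; have [w [Sw ->]] : scaleL l S k by rewrite -kl; exists 1; rewrite mulr1.
by rewrite mulKr.
Qed.

Lemma unitN1_quot k l : k \is a GRing.unit -> l \is a GRing.unit ->
  scaleL k S = scaleL l S -> N k = N l -> unitN1 S (l^-1 * k).
Proof.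
move=> uk ul kl Nkl; apply: (unitN1_of_inv _ (k^-1 * l)).
- exact: scaleS_mem.
- exact: scaleS_mem.
- by rewrite mulrA mulrK // mulVr.
- by rewrite normM normV // Nkl mulVf ?unit_norm_neq0.
Qed.

(* A generator [k] of [I] has [N k = s] only up to a unit [r] of [R]; with
   [u = delta / k^3], of norm [r^3], the generator [k u / r] has norm [s]. *)
Lemma kernel_generator q : inQ R S q -> cl_equiv S q.1.1 -> exists k, generates q k.
Proof.
case: q => [[I d] s] Qq [k [uk /= /set_eqE IE]]; move: Qq; rewrite IE => {I IE} Qq.
have := balanced_cube _ Qq; rewrite cubeL_scale /= => kd.
have [[/= _ ud sN0 _ [idx sd]] _] := Qq.
have [Rr RrV] := index_is_scale _ _ uk sN0 idx.
have NkN0 := unit_norm_neq0 _ uk; set r := s / N k in Rr.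
have rN0 : r != 0 by rewrite mulf_neq0 ?invr_eq0.
have uk3 : k ^+ 3 \is a GRing.unit by rewrite unitrX.
pose u := (k ^+ 3)^-1 * d.
have Su : S u by apply: scaleS_mem.
have uu : u \is a GRing.unit by rewrite unitrMl ?unitrV.
have SuV : S u^-1 by rewrite invrM ?unitrV // invrK; apply: scaleS_mem.
have Nu : N u = r ^+ 3.
  by rewrite normM normV // normX -sd /r expr_div_n mulrC.
(* Here [N v = r ^- 2 * r ^+ 3 = r], exactly the defect between [N k] and [s]. *)
pose v := r^-1 *: u.
have vr : v * (r *: u^-1) = 1.
  by rewrite -scalerAl -scalerAr scalerA mulVf // scale1r mulrV.
have uv := mulL1_unit _ _ vr.
have vV : v^-1 = r *: u^-1 by rewrite -[LHS]mulr1 -vr mulKr.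
have Sv : S v by apply: SZ => //; rewrite /r invf_div.
have SvV : S v^-1 by rewrite vV; apply: SZ.
exists (k * v); split=> /=; first by rewrite unitrMl.
  by rewrite -scaleLM (scaleL_unitS v).
by rewrite normM normZ Nu /r; field; rewrite sN0 NkN0.
Qed.

(** By [balanced_cube], [k ^+ 3] and [delta] generate the same ideal, and both have norm
    [s ^+ 3]. *)
Lemma unitN1_of_generates q k : inQ R S q -> generates q k ->
  unitN1 S (q.1.2 * k ^- 3).
Proof.
case: q => [[I d] s] Qq [/= uk IE Nk]; move: Qq; rewrite IE => {I IE} Qq.
have := balanced_cube _ Qq; rewrite cubeL_scale /= => kd.
have [[/= _ ud sN0 _ [_ sd]] _] := Qq.
have uk3 : k ^+ 3 \is a GRing.unit by rewrite unitrX.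
rewrite mulLC; apply: unitN1_quot => //.
by rewrite -sd normX Nk.
Qed.

(* On the representatives [(S, u, 1)] the generator is taken to be [1], so that
   every unit of norm [1] is attained on the nose. *)
Definition kernel_map q : L :=
  if boolp.pselect (q.1.1 = S /\ q.2 = 1) then q.1.2
  else if boolp.pselect (exists k, generates q k) is left kP
  then q.1.2 * (sval (boolp.constructive_indefinite_description kP)) ^- 3
  else 1.

(** Hides the choice of generator: both relevant branches have the form [delta / k^3], with [k = 1]
    on the special representatives. *)
Lemma kernel_mapP q : inQ R S q -> cl_equiv S q.1.1 ->
  exists2 k, generates q k & kernel_map q = q.1.2 * k ^- 3.
Proof.
move=> Qq kq; rewrite /kernel_map.
case: (boolp.pselect (q.1.1 = S /\ q.2 = 1)) => [[IS s1]|?] /=.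
  exists 1; last by rewrite expr1n invr1 mulr1.
  split; rewrite ?unitr1 ?norm1 // IS scaleL_unitS ?invr1 ?unitr1 //.
case: (boolp.pselect (exists k, generates q k)) => [kP|]; last by case; apply: kernel_generator.
by case: (boolp.constructive_indefinite_description kP) => k /= gk; exists k.
Qed.

(** An equivalence by [l] and a unit [x] of norm 1 determine each other through [x = l * k / k'].
    Taking [q = q'] compares two generators of the same quadruple. *)
Lemma generates_qequiv q q' k k' : inQ R S q -> inQ R S q' ->
  generates q k -> generates q' k' ->
  (qequiv q q' <-> exists c : L, cubeN1 S c /\ q'.1.2 * k' ^- 3 = c * (q.1.2 * k ^- 3)).
Proof.
move=> Qq Qq' [uk IE Nk] [uk' IE' Nk']; split.
  move=> [l [ul /set_eqE + dE sE]]; rewrite IE' IE scaleLM => klE.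
  have ulk : l * k \is a GRing.unit by rewrite unitrMl.
  have Nlk : N (l * k) = N k' by rewrite normM Nk Nk' sE.
  exists ((k'^-1 * (l * k)) ^+ 3); split.
    by exists (k'^-1 * (l * k)); split=> //; apply: unitN1_quot.
  rewrite dE !exprML exprVn.
  transitivity (k' ^- 3 * l ^+ 3 * q.1.2 * (k ^+ 3 * k ^- 3)); last by ringL.
  by rewrite mulrV ?unitrX //; ringL.
move=> [_ [[x [x1 ->]]]] E; have [ux [SVx _ _]] := unitN1_inv _ x1.
have [Sx _ Nx] := x1.
exists (x * k' * k^-1); split.
- by rewrite !unitrMl ?unitrV.
- rewrite IE IE' scaleLM mulrVK // [x * _]mulLC -scaleLM (scaleL_unitS x) //.
- rewrite !exprML exprVn; transitivity (q'.1.2 * k' ^- 3 * k' ^+ 3).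
    by rewrite mulrVK // unitrX.
  by rewrite E; ringL.
- by rewrite !normM Nx mul1r normV // Nk Nk' mulfVK // -Nk unit_norm_neq0.
Qed.

(** * Products of balanced quadruples *)

Lemma frac_idealS_prod I J : invertibleS R S I -> frac_idealS R S J ->
  frac_idealS R S (prodL I J).
Proof.
move=> invI fJ; have [fI _] := invI.
(* Outside the zero prime means nonzero, so a local generator there is a unit of [L] lying in [I],
   as [latticeL_prod] needs. *)
have pr0 := prime_ideal0 _ _ subR.
have [x gx] := invertible_locgen _ _ invI pr0.
have ux := locgen_unit _ _ _ pr0 gx; case: gx => y [Ix _ _].
split; first by apply: (latticeL_prod _ _ x) => //; [case: fI | case: fJ].
by have [] := prodL_Smod _ _ (frac_idealS_Smod _ fI) (frac_idealS_Smod _ fJ).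
Qed.

Lemma invertibleS_prod I J : invertibleS R S I -> invertibleS R S J ->
  invertibleS R S (prodL I J).
Proof.
move=> invI invJ; have [fI [I' [fI' /set_eqE II']]] := invI.
have [fJ [J' [fJ' /set_eqE JJ']]] := invJ.
have [mI mI'] := (frac_idealS_Smod _ fI, frac_idealS_Smod _ fI').
have [mJ mJ'] := (frac_idealS_Smod _ fJ, frac_idealS_Smod _ fJ').
split; first exact: frac_idealS_prod.
exists (prodL I' J'); split; last by rewrite prodLACA // II' JJ' prodSL.
by apply: frac_idealS_prod => //; split=> //; exists I; rewrite prodLC // II'.
Qed.

Lemma cubeL_prod I J : Smod I -> Smod J ->
  cubeL (prodL I J) = prodL (cubeL I) (cubeL J).
Proof.
move=> mI mJ; rewrite /cubeL [prodL (prodL I J) (prodL I J)]prodLACA //.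
by rewrite prodLACA //; apply: prodL_Smod.
Qed.

Lemma inQ_qmul q q' : inQ R S q -> inQ R S q' -> inQ R S (qmul q q').
Proof.
move=> Qq Qq'; have [mI mI'] := (inQ_Smod _ Qq, inQ_Smod _ Qq').
have [cI cI'] := (balanced_cube _ Qq, balanced_cube _ Qq').
have [[_ ud sN0 _ [idx sd]] invI] := Qq.
have [[_ ud' sN0' _ [idx' sd']] invI'] := Qq'.
have invII' := invertibleS_prod _ _ invI invI'.
split=> //; split=> /=; first by case: invII'.
- by rewrite unitrMl.
- by rewrite mulf_neq0.
- move=> v; rewrite cubeL_prod // cI cI' prodL_scale ?prodSL //; exact: Smod_S.
split; last by rewrite exprMn sd sd' normM.
(* Multiplicativity of the index is checked on the local generator [x * x']. *)
apply: locdvd_index_is => [|P prP]; first exact: prodL_Smod.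
have [x gx] := invertible_locgen _ _ invI prP.
have [x' gx'] := invertible_locgen _ _ invI' prP.
have [xs sx] := index_is_locdvd _ _ _ _ mI idx prP gx.
have [xs' sx'] := index_is_locdvd _ _ _ _ mI' idx' prP gx'.
exists (x * x'); rewrite normM; split; first exact: locgen_prod.
  exact: locdvd_mul.
exact: locdvd_mul.
Qed.

Lemma qequiv_qmul q1 q1' q2 q2' : Smod q1.1.1 -> Smod q2.1.1 ->
  qequiv q1 q1' -> qequiv q2 q2' -> qequiv (qmul q1 q2) (qmul q1' q2').
Proof.
move=> m1 m2 [k [uk /set_eqE IE dE sE]] [l [ul /set_eqE JE eE tE]].
exists (k * l); split=> /=.
- by rewrite unitrMl.
- by rewrite IE JE prodL_scale.
- by rewrite dE eE; ringL.
- by rewrite sE tE normM; ring.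
Qed.

Lemma invertibleS_S : invertibleS R S S.
Proof. by split=> //; exists S; rewrite prodSL. Qed.

(** These quadruples attain every unit of norm 1 under [kernel_map]. *)
Lemma inQ_unit u : unitN1 S u -> inQ R S (S, u, 1).
Proof.
move=> u1; have [uu [SVu _ _]] := unitN1_inv _ u1; have [Su _ Nu] := u1.
have SS : scaleL 1 S = S by apply: scaleL_unitS; rewrite ?invr1 ?unitr1.
split; last exact: invertibleS_S.
split=> //=; first exact: oner_neq0.
  by move=> v; rewrite -{1}SS cubeL_scale expr1n SS scaleL_unitS.
split; last by rewrite expr1n Nu.
apply: locdvd_index_is => // P prP; exists 1; rewrite norm1.
split; try exact: locdvd_refl.
by rewrite -SS; apply: locgen_scale => //; apply: unitr1.
Qed.

(** The identity is [N (x * y) * N x' = N (x' * y) * N x]. Used in both directions, it shows that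
    two local generators of one ideal have the same norm up to a unit at [P]. *)
Lemma locgen_locdvd P I x x' : locgen P I x -> I x' -> locdvd P (N x) (N x').
Proof.
move=> [y [Ix Sy nP]] Ix'; exists (N (x * y)), (N (x' * y)); split=> //.
- by apply: norm_S; apply: Sy.
- by apply: norm_S; apply: Sy.
- by rewrite !normM; ring.
Qed.

Lemma scale_refl I : scaleL 1 I = I.
Proof.
apply: set_eqE => v; split=> [[w [Iw ->]]|Iv]; first by rewrite mul1r.
by exists v; rewrite mul1r.
Qed.

Lemma balanced_image q : inQ R S q -> in_ClSR3 R S q.1.1.
Proof.
move=> Qq; have cI := balanced_cube _ Qq.
case: Qq => [[_ ud sN0 _ [idx _]] invI]; split=> //; first by exists q.2.
by exists q.1.2; rewrite cI.
Qed.

(* With [J^3 = k S] and [[S : J] = c R], the quotient [r = N k / c^3] is a unit of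
   [R], and [(J, r k, r c)] is balanced. *)
Lemma balanced_lift J : in_ClSR3 R S J -> exists q, inQ R S q /\ cl_equiv J q.1.1.
Proof.
move=> [invJ [c [cN0 idx]] [k [uk /set_eqE cubJ]]].
have [fJ _] := invJ; have mJ := frac_idealS_Smod _ fJ.
have NkN0 := unit_norm_neq0 _ uk; have c3N0 := expf_neq0 3 cN0.
have loc P : prime_idealR R P -> locdvd P (c ^+ 3) (N k) /\ locdvd P (N k) (c ^+ 3).
  move=> prP; have [x gx] := invertible_locgen _ _ invJ prP.
  have [xc cx] := index_is_locdvd _ _ _ _ mJ idx prP gx.
  (* Both [x ^+ 3] and [k] generate [J^3 = k S] at [P], so [N x ^+ 3], and with it [c ^+ 3], agrees
     with [N k] up to a unit there. *)
  have g3 := locgen_cube _ _ _ prP mJ gx; rewrite cubJ in g3.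
  have gk := locgen_scale _ _ prP uk.
  have [_ [x3 _ _]] := g3; have [_ [kk _ _]] := gk.
  have := locgen_locdvd _ _ _ _ g3 kk; have := locgen_locdvd _ _ _ _ gk x3.
  rewrite normX => kx xk; split.
    exact: (locdvd_trans _ _ _ _ prP (locdvd_exp _ _ _ 3 prP cx) xk).
  exact: (locdvd_trans _ _ _ _ prP kx (locdvd_exp _ _ _ 3 prP xc)).
pose r := N k / c ^+ 3.
have Rr : R r by apply: locdvd_global => // P /loc[].
have RrV : R r^-1 by rewrite invf_div; apply: locdvd_global => // P /loc[].
have rN0 : r != 0 by rewrite mulf_neq0 ?invr_eq0.
exists (J, r *: k, r * c); split; last first.
  by exists 1; rewrite scale_refl; split=> //; apply: unitr1.
split=> //; split=> //=.
- by apply: norm_neq0_unit; rewrite normZ mulf_neq0 ?expf_neq0.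
- by rewrite mulf_neq0.
- move=> v; rewrite cubJ => -[w [Sw ->]]; exists (r^-1 *: w).
  by rewrite -scalerAl -scalerAr scalerA divff ?scale1r //; split=> //; apply: SZ.
(* By the choice of [r], [N (r k) = r ^+ 2 * N k = r ^+ 3 * c ^+ 3]. *)
split; last by rewrite normZ /r; field.
apply: locdvd_index_is => // P prP; have [x gx] := invertible_locgen _ _ invJ prP.
have [[b [d [Rb nPb Rd E]]] [b' [d' [Rb' nPb' Rd' E']]]] :=
  index_is_locdvd _ _ _ _ mJ idx prP gx.
exists x; split=> //.
  by exists b, (r * d); split=> //; [apply: subringKM | rewrite mulrCA E; ring].
exists b', (d' / r); split=> //; first exact: subringKM.
by rewrite E'; field.
Qed.

Lemma generates_qmul q q' k k' : generates q k -> generates q' k' ->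
  generates (qmul q q') (k * k').
Proof.
move=> [uk IE Nk] [uk' IE' Nk']; split=> /=; first by rewrite unitrMl.
  by rewrite IE IE' prodL_scale ?prodSL //; apply: Smod_S.
by rewrite normM Nk Nk'.
Qed.

Lemma generates_cl_equiv q k : generates q k -> cl_equiv S q.1.1.
Proof. by move=> [uk -> _]; exists k. Qed.

Lemma qequiv_refl q : qequiv q q.
Proof.
exists 1; rewrite scale_refl expr1n norm1 !mul1r.
by split=> //; apply: unitr1.
Qed.

(** The product is generated by [k * k'], but [kernel_map] may use another generator [l];
    [generates_qequiv], applied to the product and itself, shows that the discrepancy is the cube of
    a unit of norm 1. *)
Lemma kernel_map_qmul q q' : inQ R S q -> cl_equiv S q.1.1 ->
  inQ R S q' -> cl_equiv S q'.1.1 ->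
  exists c : L, cubeN1 S c /\
    kernel_map (qmul q q') = c * (kernel_map q * kernel_map q').
Proof.
move=> Qq kq Qq' kq'; have [k gk ->] := kernel_mapP _ Qq kq.
have [k' gk' ->] := kernel_mapP _ Qq' kq'.
have Q2 := inQ_qmul _ _ Qq Qq'; have g2 := generates_qmul _ _ _ _ gk gk'.
have [l gl ->] := kernel_mapP _ Q2 (generates_cl_equiv _ _ g2).
have [c [c3 ->]] := (generates_qequiv _ _ _ _ Q2 Q2 g2 gl).1 (qequiv_refl _).
exists c; split=> //=; rewrite -!exprVn; case: gk gk' => uk _ _ [uk' _ _].
by rewrite invrM //; ringL.
Qed.

Lemma kernel_map_unit u : kernel_map (S, u, 1) = u.
Proof.
rewrite /kernel_map; case: (boolp.pselect _) => //=.
by case.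
Qed.
End QuadraticAlgebra.

Theorem mainTheorem4 (K : fieldType) (L : falgType K)
    (R : K -> Prop) (a : K -> Prop) (S : L -> Prop) (omega : L -> L -> K) :
  dedekind_with_frac_field R ->
  (3%:R : K) != 0 ->
  frac_idealR R a ->
  L_commutative L -> \dim {:L} = 2%N ->
  quadratic_alg R S -> nondegenerateLK L ->
  orientation R S a omega ->
  [/\
    (* the map q = (I, delta, s) |-> [I] lands in Cl(S/R)[3] and is
       well defined on ~-classes *)
    (forall q, inQ R S q -> in_ClSR3 R S q.1.1)
      /\ (forall q q', inQ R S q -> inQ R S q' -> qequiv q q' ->
            cl_equiv q.1.1 q'.1.1),
    (* the componentwise product is well defined on classes (the map is then
       multiplicative, since the first component of qmul q q' is I I') *)
    (forall q q', inQ R S q -> inQ R S q' -> inQ R S (qmul q q'))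
      /\ (forall q1 q1' q2 q2', inQ R S q1 -> inQ R S q1' -> inQ R S q2 ->
            inQ R S q2' -> qequiv q1 q1' -> qequiv q2 q2' ->
            qequiv (qmul q1 q2) (qmul q1' q2')),
    (* surjectivity onto Cl(S/R)[3] *)
    (forall J, in_ClSR3 R S J -> exists q, inQ R S q /\ cl_equiv J q.1.1)
  & (* the kernel is isomorphic to S^x_{N=1} / (S^x_{N=1})^3 *)
    exists F : quad L -> L,
      [/\ (forall q, inQ R S q -> cl_equiv S q.1.1 -> unitN1 S (F q)),
          (forall q q', inQ R S q -> cl_equiv S q.1.1 ->
                        inQ R S q' -> cl_equiv S q'.1.1 ->
             (qequiv q q' <-> exists c, cubeN1 S c /\ F q' = c * F q)),
          (forall u, unitN1 S u ->
             exists q, [/\ inQ R S q, cl_equiv S q.1.1 & F q = u])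
        & (forall q q', inQ R S q -> cl_equiv S q.1.1 ->
                        inQ R S q' -> cl_equiv S q'.1.1 ->
             exists c, cubeN1 S c /\ F (qmul q q') = c * (F q * F q'))]].
Proof.
move=> dedR _ fracA mulLC dimL quadS _ orS; split.
- split=> [q|q q' _ _ [k [uk IE _ _]]]; last by exists k.
  exact: (balanced_image K L R a S omega).
- split=> [q q'|q1 q1' q2 q2' Q1 _ Q2 _].
    exact: (inQ_qmul K L R a S omega).
  by apply: (qequiv_qmul K L R a S omega) => //; apply: inQ_Smod.
- exact: (balanced_lift K L R a S omega).
exists (kernel_map K L S); split.
- move=> q Qq kq.
  have [k gk ->] := kernel_mapP K L R a S omega dedR fracA mulLC dimL quadS orS q Qq kq.
  exact: (unitN1_of_generates K L R a S omega).
- move=> q q' Qq kq Qq' kq'.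
  have [k gk ->] := kernel_mapP K L R a S omega dedR fracA mulLC dimL quadS orS q Qq kq.
  have [k' gk' ->] := kernel_mapP K L R a S omega dedR fracA mulLC dimL quadS orS q' Qq' kq'.
  exact: (generates_qequiv K L R a S omega).
- move=> u u1; exists (S, u, 1); split; last exact: kernel_map_unit.
    exact: (inQ_unit K L R a S omega).
  by exists 1; rewrite scale_refl; split=> //; apply: unitr1.
- exact: (kernel_map_qmul K L R a S omega).
Qed.
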